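(* Let $n, m$ be positive integers and let $G$ be a graph in $\ell_n^m$, that is, a cactus on $n$ vertices with matching number $m$. (i) If $n=2m+1$, then $q(G)\leq\frac{(n+2)+\sqrt{n^2-4n+12}}{2}$, with equality if and only if $G \cong H_m^0$. (ii) If $n\geq 2m+2$, then $q(G) \leq q(H_{m-1}^{n-2m+1})$, with equality if and only if $G \cong H_{m-1}^{n-2m+1}$, where $q(H_{m-1}^{n-2m+1})$ is the largest root of the equation $x^3 - (n+3)x^2 + 3nx - 4m +4 =0$.
   Context: All graphs are finite, undirected and simple (no loops or multiple edges). A graph $G$ is a cactus if it is connected and any two of its cycles have at most one common vertex. The matching number of $G$ is the maximum cardinality of a set of pairwise independent edges (edges with no common end vertex). $\ell_n^m$ denotes the set of cacti with $n$ vertices and matching number $m$. For a graph $G$ on vertices $v_1,\dots,v_n$ with degrees $d_1,\dots,d_n$ and adjacency matrix $A(G)$, the signless Laplacian matrix is $Q(G)=\mathrm{diag}(d_1,\dots,d_n)+A(G)$, and $q(G)$ denotes its largest eigenvalue (the signless Laplacian spectral radius of $G$). For nonnegative integers $s,k$, $H_s^k$ is the graph on $2s+k+1$ vertices consisting of $s$ triangles that all share one common vertex $v_0$ (and are otherwise disjoint), together with $k$ pendant vertices each adjacent only to $v_0$. *)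

(* Defs.v *)
From HB Require Import structures.
From mathcomp Require Import all_boot all_order all_algebra.
From mathcomp Require Import classical_sets reals.

Set Implicit Arguments.
Unset Strict Implicit.
Unset Printing Implicit Defensive.

Import Order.TTheory GRing.Theory Num.Theory.

Record sgraph := SGraph {
  vertex :> finType;
  adj : rel vertex;
  adj_sym : symmetric adj;
  adj_irrefl : irreflexive adj }.

Definition isomorphic (G H : sgraph) : Prop :=
  exists2 f : G -> H, bijective f & {mono f : x y / adj x y}.

Definition connected (G : sgraph) : Prop :=
  forall x y : G, connect (@adj G) x y.

Definition is_cycle (G : sgraph) (c : seq G) : bool :=
  (2 < size c) && ucycleb (@adj G) c.

(* The edges of the cycle subgraph traversed by c; the same cycle is listed by
   several sequences (rotations, reversal), but these all have the same edges. *)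
Definition cycle_edges (G : sgraph) (c : seq G) : {set {set G}} :=
  [set [set x; next c x] | x in c].

Definition cactus (G : sgraph) : Prop :=
  connected G /\
  forall c1 c2 : seq G, is_cycle c1 -> is_cycle c2 ->
    cycle_edges c1 != cycle_edges c2 ->
    #|[set x | (x \in c1) && (x \in c2)]| <= 1.

Definition edges (G : sgraph) : {set {set G}} :=
  [set [set e.1; e.2] | e : G * G & adj e.1 e.2].

Definition matching (G : sgraph) (M : {set {set G}}) : bool :=
  (M \subset edges G) && finset.trivIset M.

Definition matching_number (G : sgraph) : nat :=
  \max_(M : {set {set G}} | matching M) #|M|.

Definition cacti (n m : nat) (G : sgraph) : Prop :=
  [/\ cactus G, #|G| = n & matching_number G = m].

Section SignlessLaplacian.
Variables (R : realType) (G : sgraph).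
Local Open Scope ring_scope.

Definition degree (x : G) : nat := #|[set y | adj x y]|.

Definition adjacency_mx : 'M[R]_#|G| :=
  \matrix_(i, j) (adj (enum_val i) (enum_val j))%:R.

Definition signless_laplacian : 'M[R]_#|G| :=
  diag_mx (\row_i (degree (enum_val i))%:R) + adjacency_mx.

(* The set of eigenvalues is finite, and nonempty when G has a vertex since the
   matrix is symmetric; hence this supremum is the largest eigenvalue. *)
Definition q : R := sup [set x : R | eigenvalue signless_laplacian x]%classic.

End SignlessLaplacian.

(* None is the common vertex v0; Some (inl (i, b)), for b a boolean, are the
   other two vertices of the i-th triangle; Some (inr j) are the pendants. *)
Definition H_vertex (s k : nat) : finType := option ('I_s * bool + 'I_k)%type.

Definition H_adj (s k : nat) : rel (H_vertex s k) := fun x y =>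
  match x, y with
  | None, Some _ | Some _, None => true
  | Some (inl (i, b)), Some (inl (j, c)) => (i == j) && (b != c)
  | _, _ => false
  end.

Lemma H_adj_sym s k : symmetric (@H_adj s k).
Proof.
by move=> [[[i b]|i]|] [[[j c]|j]|] //=; rewrite eq_sym [b == c]eq_sym.
Qed.

Lemma H_adj_irrefl s k : irreflexive (@H_adj s k).
Proof. by move=> [[[i b]|i]|] //=; rewrite !eqxx. Qed.

Definition H (s k : nat) : sgraph := SGraph (@H_adj_sym s k) (@H_adj_irrefl s k).

Definition is_largest_root (R : realType) (f : R -> R) (x : R) : Prop :=
  f x = 0%R /\ forall y : R, f y = 0%R -> (y <= x)%R.

(* Main.v *)
Require Import Defs.
From HB Require Import structures.
From mathcomp Require Import classical_sets reals.
From mathcomp Require Import all_boot all_order all_algebra.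
From mathcomp Require Import ring lra zify.
Import Order.TTheory GRing.Theory Num.Theory.

(** The proof compares the cactus with its spectral bound through positive test
    functions.  If x > 0 and Q x <= la x pointwise, then every eigenvalue of Q
    is at most la ([eigenvalue_le]), and if Q x = la x then la is the largest
    one ([q_positive_eigenfunction]).

    Suppose first that no vertex is adjacent to all others.  The test function
    is the degree: Q d <= n d says that, for every vertex v,
    the degrees of the neighbours of v sum to at most (n - d v) * d v
    ([sum_neighbour_degrees_le]).  This is a count of paths v - u - y.  In a
    cactus, a neighbour u of v is adjacent to at most one vertex y that closes
    a cycle through v and u, because two such cycles would share v and u
    ([near_unique]); the vertices y that close no such cycle are reached by at
    most one path each.  The count is exact enough except when a single vertex
    is not adjacent to v and the neighbours of v are perfectly matched among
    themselves; then the whole graph has a perfect matching, which n > 2m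
    forbids.  Hence q G <= n, while the bounds of both parts exceed n as soon
    as m >= 2.  A connected graph with m = 1 does have a dominating vertex
    ([dominating_of_matching_number1]).

    Suppose now that v is adjacent to all other vertices.  These induce a
    graph of maximum degree at most 1, so G is some H s k
    ([dominating_isomorphic]).  For n >= 2m + 2 the matching number s + 1
    determines s and k.  For n = 2m + 1 either k = 0, or k > 0 and q (H s k)
    is strictly below the bound ([q_H_lt_friendship_bound]).

    The value of q (H s k) comes from the positive function that is constant
    on the centre, on the triangles and on the pendants: it is an eigenfunction
    exactly at the roots of the cubic [H_poly]. *)

(** * Cycles through a vertex of a cactus *)

(** Two cycles of a cactus with two common vertices have the same edges, hence
    the same vertices.  In this form no edge set has to be compared again: it
    suffices to exhibit a vertex on one cycle but not on the other. *)
Lemma cactus_cycles (G : sgraph) (c1 c2 : seq G) (x y z : G) :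
  cactus G -> is_cycle c1 -> is_cycle c2 -> x != y ->
  x \in c1 -> y \in c1 -> x \in c2 -> y \in c2 -> z \in c1 -> z \in c2.
Proof.
move=> [_ cactG] cyc1 cyc2 xy x1 y1 x2 y2 z1; apply: contraT => z2.
have diff : cycle_edges c1 != cycle_edges c2.
  apply/eqP => E; have : [set z; next c1 z] \in cycle_edges c1.
    by apply/imsetP; exists z.
  rewrite E => /imsetP [w w2 /setP /(_ z)].
  rewrite !inE eqxx /= => /esym /orP [] /eqP zE.
    by rewrite zE w2 in z2.
  by rewrite zE mem_next w2 in z2.
have := cactG _ _ cyc1 cyc2 diff; rewrite leqNgt => /negP [].
apply: leq_trans (_ : #|[set x; y]| <= _); first by rewrite cards2 xy.
by apply/subset_leq_card/subsetP => w; rewrite !inE => /orP [] /eqP ->;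
   apply/andP.
Qed.

Definition codegree (G : sgraph) (v y : G) : nat :=
  #|[set u | adj v u && adj u y]|.

(** A vertex y adjacent to a neighbour u of v is near v when the path v - u - y
    closes to a triangle or to a quadrangle through v. *)
Definition near (G : sgraph) (v y : G) : bool :=
  (y != v) && (adj v y || (1 < codegree G v y)).

Lemma near_cycle (G : sgraph) (v u y : G) :
  adj v u -> adj u y -> near G v y ->
  exists2 c : seq G, is_cycle c & [/\ v \in c, u \in c, y \in c
    & forall x, x \in c -> (x \in [:: v; u; y]) || adj v x && ~~ adj v y].
Proof.
move=> vu uy /andP [yv].
have irr (x w : G) : adj x w -> x != w.
  by move=> xw; apply/eqP => E; rewrite E adj_irrefl in xw.
have [vy _|nvy /= dbl] := boolP (adj v y).
  exists [:: v; u; y]; last first.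
    by split; rewrite ?inE ?eqxx ?orbT // => x ->.
  rewrite /is_cycle /ucycleb /= vu uy adj_sym vy /= !inE.
  by rewrite negb_or !irr.
have /card_gt0P [b] : 0 < #|[set b | adj v b && adj b y] :\ u|.
  have := cardsD1 u [set b | adj v b && adj b y].
  by move: dbl; rewrite /codegree inE vu uy /=; lia.
rewrite !inE => /and3P [bu vb b_y].
exists [:: v; u; y; b]; last first.
  split; rewrite ?inE ?eqxx ?orbT // => x.
  rewrite !inE -!orbA => /or4P [] /eqP ->; rewrite ?eqxx ?orbT //.
  by rewrite vb /= !orbT.
rewrite /is_cycle /ucycleb /= vu uy (adj_sym y) b_y (adj_sym b v) vb /= !inE.
by rewrite !negb_or (irr _ _ vu) (irr _ _ uy) (eq_sym v y) yv (irr _ _ vb)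
  (eq_sym u b) bu (eq_sym y b) (irr _ _ b_y).
Qed.

(** Otherwise the closing cycles of y and y' share v and u.  The cycle closed
    by y' contains, besides v, u and y', at most one more vertex, which is then
    a neighbour of v while y' is not; so y can only lie on it if y is a
    neighbour of v and y' is not, and exchanging y and y' excludes this. *)
Lemma near_unique (G : sgraph) (v u y y' : G) : cactus G ->
  adj v u -> adj u y -> adj u y' -> near G v y -> near G v y' -> y = y'.
Proof.
move=> cactG vu.
wlog vyy' : y y' / adj v y -> adj v y'.
  move=> IH uy uy' ny ny'; have [vy|nvy] := boolP (adj v y).
    by apply/esym/IH.
  by apply: IH => // vy; rewrite vy in nvy.
move=> uy uy' ny ny'.
have [c cyc [vc uc yc _]] := near_cycle G v u y vu uy ny.
have [c' cyc' [vc' uc' _ c'P]] := near_cycle G v u y' vu uy' ny'.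
have vNu : v != u by apply/eqP => E; rewrite E adj_irrefl in vu.
have /c'P := cactus_cycles G c c' v u y cactG cyc cyc' vNu vc uc vc' uc' yc.
case/orP => [|/andP [/vyy' ->] //]; rewrite !inE => /or3P [] /eqP // E.
  by move: ny; rewrite /near E eqxx.
by rewrite E adj_irrefl in uy.
Qed.

(** * Degree sums over a neighbourhood *)

Lemma card_setI_sum (T : finType) (P Q : pred T) :
  #|[set x | P x && Q x]| = \sum_(x | P x) Q x.
Proof.
by rewrite -sum1dep_card big_mkcondr /=; apply: eq_bigr => x _; case: (Q x).
Qed.

(** Paths v - u - y with P y, counted by their end and by their midpoint. *)
Lemma sum_codegree (G : sgraph) (v : G) (P : pred G) :
  \sum_(y | P y) codegree G v y =
  \sum_(u | adj v u) #|[set y | P y && adj u y]|.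
Proof.
rewrite /codegree; under eq_bigr do rewrite card_setI_sum.
rewrite exchange_big; apply: eq_bigr => u _ /=; by rewrite card_setI_sum.
Qed.

Lemma near_adj (G : sgraph) (v u : G) : adj v u -> near G v u.
Proof.
move=> vu; rewrite /near vu andbT.
by apply/eqP => E; rewrite E adj_irrefl in vu.
Qed.

Lemma card_near_adj (G : sgraph) (v u : G) : cactus G -> adj v u ->
  #|[set y | near G v y && adj u y]| <= 1.
Proof.
move=> cactG vu; apply/card_le1_eqP => y y'.
rewrite !inE => /andP [ny uy] /andP [ny' uy'].
exact: (near_unique G v u).
Qed.

(** Paths v - u - y, split according to whether y is v itself, near v, or
    neither. *)
Lemma sum_neighbour_degrees (G : sgraph) (v : G) :
  \sum_(u | adj v u) degree u =
  degree v + \sum_(y | near G v y) codegree G v y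
    + \sum_(y | (y != v) && ~~ near G v y) codegree G v y.
Proof.
have -> : degree v = codegree G v v.
  by apply: eq_card => u; rewrite !inE (adj_sym u) andbb.
have := sum_codegree G v xpredT; rewrite /degree /= => <-.
rewrite (bigD1 v) //= -addnA (bigID (near G v)) /=; congr (_ + (_ + _)).
by apply: eq_bigl => y; rewrite /near; case: eqP.
Qed.

(** Each midpoint u has at most one continuation to a vertex near v, and a
    midpoint without any continuation saves one unit.  That unit is needed when
    a single vertex is not adjacent to v. *)
Lemma sum_near_codegree (G : sgraph) (v : G) : cactus G ->
  \sum_(y | near G v y) codegree G v y <= degree v /\
  (forall u, adj v u -> (forall y, near G v y -> adj u y = false) ->
    \sum_(y | near G v y) codegree G v y < degree v).
Proof.
move=> cactG; rewrite sum_codegree.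
have -> : degree v = \sum_(u | adj v u) 1 by rewrite sum1dep_card.
split; first by apply: leq_sum => u vu; apply: card_near_adj.
move=> u vu none; rewrite (bigD1 u) //= [ltnRHS](bigD1 u) //=.
rewrite eq_card0 => [|y]; last first.
  by rewrite !inE; case: (boolP (near G v y)) => // /none.
rewrite add0n add1n ltnS; apply: leq_sum => w /andP [vw _].
exact: card_near_adj.
Qed.

(** * Matchings from involutions *)

(** The orbits of size two of an involution that moves vertices along edges
    are the edges of a matching; this turns lower bounds for the matching number
    into the construction of a function on the vertices. *)
Lemma involution_matching (G : sgraph) (t : G -> G) :
  involutive t -> (forall x, t x != x -> adj x (t x)) ->
  #|[set x | t x != x]| <= 2 * matching_number G.
Proof.
move=> tK t_adj; pose D := [set x | t x != x].
pose M := [set [set x; t x] | x in D].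
have blockE x z : z \in [set x; t x] -> [set x; t x] = [set z; t z].
  by rewrite !inE => /orP [] /eqP -> //; rewrite tK setUC.
have trivM : trivIset M.
  apply/trivIsetP => A B /imsetP [x _ ->] /imsetP [y _ ->].
  apply: contraNT => /pred0Pn [z] /andP [/= /blockE -> /blockE ->].
  exact: eqxx.
have partM : partition M D.
  apply/and3P; split=> //.
    apply/eqP/setP => z; apply/bigcupP/idP => [[A /imsetP [x xD ->]]|zD].
      move: xD; rewrite !inE => xD /orP [] /eqP -> //.
      by rewrite tK eq_sym.
    by exists [set z; t z]; rewrite ?inE ?eqxx //; apply/imsetP; exists z.
  apply/imsetP => -[x _ /setP /(_ x)]; by rewrite !inE eqxx.
have -> : #|[set x | t x != x]| = #|M| * 2.
  apply: card_uniform_partition partM => A /imsetP [x].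
  by rewrite inE => xD ->; rewrite cards2 eq_sym xD.
rewrite mulnC leq_mul2l /=; apply: leq_bigmax_cond.
apply/andP; split=> //; apply/subsetP => A /imsetP [x].
rewrite inE => /t_adj xt ->; apply/imsetP; exists (x, t x) => //.
by rewrite inE.
Qed.

(** The fixed points are the neighbours of v that have no neighbour in common
    with v; in a cactus this is an involution on the neighbourhood of v. *)
Definition partner (G : sgraph) (v u : G) : G :=
  odflt u [pick y | adj v y && adj u y].

Lemma partner_eq (G : sgraph) (v u y : G) : cactus G ->
  adj v u -> adj v y -> adj u y -> partner G v u = y.
Proof.
move=> cactG vu vy uy; rewrite /partner.
have nearN x : adj v x -> near G v x.
  move=> vx; rewrite /near vx andbT; apply/eqP => E.
  by rewrite E adj_irrefl in vx.
case: pickP => [z /andP [vz uz] /=|/(_ y)]; last by rewrite vy uy.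
by apply: (near_unique G v u) => //; apply: nearN.
Qed.

Variant partner_spec (G : sgraph) (v u : G) : G -> Type :=
  | PartnerNone of (forall y, adj v y -> adj u y = false) :
      partner_spec G v u u
  | PartnerSome y of adj v y & adj u y : partner_spec G v u y.

Lemma partnerP (G : sgraph) (v u : G) : partner_spec G v u (partner G v u).
Proof.
rewrite /partner; case: pickP => [y /andP [vy uy]|none] /=.
  exact: PartnerSome.
by apply: PartnerNone => y vy; have := none y; rewrite vy.
Qed.

Lemma partnerK (G : sgraph) (v u : G) : cactus G -> adj v u ->
  partner G v (partner G v u) = u.
Proof.
move=> cactG vu; case: (partnerP G v u) => [none|y vy uy].
  by case: partnerP => // y vy; rewrite none.
by apply: partner_eq => //; rewrite adj_sym.
Qed.

(** * The degree inequality *)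

Lemma degree_lt_order (G : sgraph) (v : G) : degree v < #|G|.
Proof.
rewrite /degree -[#|G|]cardsT; apply: proper_card; apply/properP; split.
  exact: subsetT.
by exists v; rewrite ?inE ?adj_irrefl.
Qed.

Lemma connected_degree_gt0 (G : sgraph) (v : G) :
  connected G -> 1 < #|G| -> 0 < degree v.
Proof.
move=> conn n1; have /card_gt0P [w] : 0 < #|[set~ v]|.
  by rewrite cardsC1; lia.
rewrite !inE => wv; have /connectP [[|x p] /= pP wE] := conn v w.
  by rewrite wE eqxx in wv.
by apply/card_gt0P; exists x; rewrite inE; case/andP: pP.
Qed.

(** A vertex that is neither v nor near v ends at most one path v - u - y and
    is not a neighbour of v, so the number of these paths is at most the number
    of vertices outside the closed neighbourhood of v. *)
Lemma sum_far_codegree (G : sgraph) (v : G) :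
  \sum_(y | (y != v) && ~~ near G v y) codegree G v y + degree v < #|G|.
Proof.
pose F := [set y | (y != v) && ~~ near G v y].
have disj : [disjoint F & [set u | adj v u]].
  apply/pred0Pn => -[y /andP []] /=; rewrite !inE => /andP [yv far] vy.
  by rewrite near_adj in far.
apply: leq_ltn_trans (_ : #|F :|: [set u | adj v u]| < _).
  rewrite cardsU disjoint_setI0 // cards0 subn0 leq_add2r -sum1dep_card.
  by apply: leq_sum => y /andP [yv]; rewrite /near yv /= negb_or -leqNgt =>
    /andP [].
rewrite -[#|G|]cardsT; apply: proper_card; apply/properP; split.
  exact: subsetT.
by exists v; rewrite ?inE ?eqxx ?adj_irrefl.
Qed.

(** When the partners match the neighbourhood of v perfectly and w is the only
    other vertex, the edge from a to its partner b is replaced by the edges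
    w - a and b - v, which also covers v and w. *)
Lemma perfect_matching_of_partners (G : sgraph) (v w a : G) : cactus G ->
  w != v -> ~~ adj v w -> (forall y, y != v -> y != w -> adj v y) ->
  (forall u, adj v u -> exists2 y, adj v y & adj u y) -> adj w a ->
  #|G| <= 2 * matching_number G.
Proof.
move=> cactG wv nvw dom partners wa.
have irr (x y : G) : adj x y -> (x == y) = false.
  by move=> xy; apply/eqP => E; rewrite E adj_irrefl in xy.
have pN u : adj v u -> adj v (partner G v u) /\ adj u (partner G v u).
  by move=> vu; have [y vy uy] := partners u vu; rewrite (partner_eq G v u y).
have pK u : adj v u -> partner G v (partner G v u) = u.
  exact: partnerK.
have va : adj v a.
  apply: dom; last by rewrite eq_sym irr.
  by apply/eqP => E; rewrite adj_sym -E wa in nvw.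
set b := partner G v a; have [vb ab] : adj v b /\ adj a b by apply: pN.
have Nw y : adj v y -> (y == w) = false.
  by move=> vy; apply/eqP => E; rewrite -E vy in nvw.
have Nv y : adj v y -> (y == v) = false.
  by move=> vy; rewrite eq_sym irr.
have ba : (b == a) = false by rewrite eq_sym irr.
have bE x : adj v x -> (partner G v x == b) = (x == a).
  move=> vx; apply/eqP/eqP => [E|->] //.
  by rewrite -(pK x vx) E pK.
have aE x : adj v x -> (partner G v x == a) = (x == b).
  move=> vx; apply/eqP/eqP => [E|->]; last exact: pK.
  by rewrite -(pK x vx) E.
pose t x := if x == v then b else if x == b then v else
  if x == w then a else if x == a then w else partner G v x.
have tK : involutive t.
  move=> x; rewrite /t.
  have [->|xv] := eqVneq x v; first by rewrite Nv // eqxx.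
  have [->|xb] := eqVneq x b; first by rewrite eqxx.
  have [->|xw] := eqVneq x w.
    by rewrite Nv // (eq_sym a) ba Nw // eqxx.
  have [->|xa] := eqVneq x a.
    by rewrite (negbTE wv) (eq_sym w) Nw // eqxx.
  have vx := dom x xv xw; have [vpx _] := pN x vx.
  by rewrite Nv // bE // (negbTE xa) Nw // aE // (negbTE xb) pK.
have t_adj x : adj x (t x).
  rewrite /t; have [->|xv] := eqVneq x v; first exact: vb.
  have [->|xb] := eqVneq x b; first by rewrite adj_sym.
  have [->|xw] := eqVneq x w; first exact: wa.
  have [->|xa] := eqVneq x a; first by rewrite adj_sym.
  by have [] := pN x (dom x xv xw).
have := involution_matching G t tK (fun x _ => t_adj x).
suff -> : [set x | t x != x] = [set: G] by rewrite cardsT.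
by apply/setP => x; rewrite !inE eq_sym irr.
Qed.

(** With n the order, d the degree of v and r = n - 1 - d, the preceding bounds
    give 2 d + r paths, and 2 d + r <= (n - d) d as soon as d, r >= 2.  The case
    d = 1 is immediate.  For r = 1 the bound has to be improved to 2 d: let w be
    the vertex not adjacent to v.  If w is near v, no path is left for vertices
    that are not near.  Otherwise some neighbour of v has no partner, or there
    is a perfect matching. *)
Lemma sum_neighbour_degrees_le (G : sgraph) (v : G) :
  cactus G -> 1 < #|G| -> 2 * matching_number G < #|G| ->
  degree v + 1 < #|G| ->
  \sum_(u | adj v u) degree u + degree v * degree v <= #|G| * degree v.
Proof.
move=> cactG n1 mn dn; have [conn _] := cactG.
have d0 := connected_degree_gt0 G v conn n1.
have [d1|d2] := leqP (degree v) 1.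
  have d1' : degree v = 1 by lia.
  have : \sum_(u | adj v u) degree u <= \sum_(u | adj v u) (#|G|).-1.
    apply: leq_sum => u _; have := degree_lt_order G u; lia.
  rewrite sum_nat_const -/(degree v).
  have -> : #|adj v| = degree v by rewrite /degree cardsE.
  rewrite d1'; lia.
rewrite sum_neighbour_degrees.
have [near_le near_lt] := sum_near_codegree G v cactG.
have far_lt := sum_far_codegree G v.
have [r2|r1] := ltnP (degree v + 2) #|G|; first by nia.
have nE : #|G| = degree v + 2 by lia.
have /cards1P [w RE] : #|[set y | (y != v) && ~~ adj v y]| == 1.
  have -> : [set y | (y != v) && ~~ adj v y]
      = ~: (v |: [set u | adj v u]).
    by apply/setP => y; rewrite !inE negb_or.
  have := cardsC (v |: [set u | adj v u]); rewrite cardsU1 inE adj_irrefl /=.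
  rewrite -/(degree v) nE; set c := #|~: _|; move: c (degree v) => c d; lia.
have wP y : (y != v) && ~~ adj v y = (y == w).
  by move/setP: RE => /(_ y); rewrite !inE.
have /andP [wv nvw] : (w != v) && ~~ adj v w by rewrite wP.
have [nw|fw] := boolP (near G v w).
  have far0 : \sum_(y | (y != v) && ~~ near G v y) codegree G v y = 0.
    apply: big_pred0 => y; apply/negbTE/negP => /andP [yv fy].
    have yw : y = w.
      apply/eqP; rewrite -wP yv; apply: contra fy; exact: near_adj.
    by rewrite yw nw in fy.
  move: far_lt near_le; rewrite far0; nia.
have nearE y : near G v y = adj v y.
  apply/idP/idP; last exact: near_adj.
  move=> ny; apply: contraT => nvy; have : y == w.
    by rewrite -wP nvy; case/andP: ny => ->.
  by move/eqP => E; rewrite -E ny in fw.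
have far1 : \sum_(y | (y != v) && ~~ near G v y) codegree G v y <= 1.
  by move: far_lt; rewrite nE; lia.
have [/existsP [u /andP [vu /forallP none]]|all_partners] := boolP
    [exists u, adj v u && [forall y, adj v y ==> ~~ adj u y]].
  have lt : \sum_(y | near G v y) codegree G v y < degree v.
    apply: (near_lt u vu) => y; rewrite nearE => vy.
    by apply/negbTE; apply: implyP (none y) vy.
  by rewrite nE; nia.
have /card_gt0P [a] := connected_degree_gt0 G w conn n1; rewrite inE => wa.
suff : #|G| <= 2 * matching_number G by lia.
apply: (perfect_matching_of_partners G v w a) => //.
  move=> y yv yw; apply: contraT => nvy; move: yw.
  by rewrite -wP yv nvy.
move=> u vu; move: all_partners => /existsPn /(_ u); rewrite vu /=.
by move=> /forallPn [y]; rewrite negb_imply negbK => /andP [vy uy]; exists y.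
Qed.

(** * Cacti with a dominating vertex *)

Lemma isomorphic_sym (G G' : sgraph) : isomorphic G G' -> isomorphic G' G.
Proof.
case=> f [g fK gK] fE; exists g; first by exists f.
by move=> x y; rewrite -fE !gK.
Qed.

(** The partner function splits the vertices other than v into fixed points,
    which become the pendants, and pairs, which become the triangles.  The order
    of [enum_rank] chooses which vertex of a pair comes first. *)
Lemma dominating_isomorphic (G : sgraph) (v : G) : cactus G ->
  (forall x, x != v -> adj v x) -> exists s k, isomorphic G (H s k).
Proof.
move=> cactG dom.
pose p := partner G v; 
pose A := [set x | (x != v) && (enum_rank x < enum_rank (p x))].
pose C := [set x | (x != v) && (p x == x)].
have neq x : adj v x -> x != v.
  by move=> vx; apply/eqP => E; rewrite E adj_irrefl in vx.
have pN x : x != v -> p x != v.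
  by rewrite /p; case: partnerP => // y vy _ _; apply: neq.
have pK x : x != v -> p (p x) = x by move=> xv; apply: partnerK => //; apply: dom.
have adjE x y : x != v -> y != v -> adj x y = (p x == y) && (x != y).
  move=> xv yv; apply/idP/andP => [xy|[/eqP <-]].
    split; last by apply/eqP => E; rewrite E adj_irrefl in xy.
    by apply/eqP; apply: partner_eq; rewrite ?dom.
  by rewrite /p; case: partnerP => //; rewrite eqxx.
pose f (h : H #|A| #|C|) : G := match h with
  | None => v
  | Some (inl (i, b)) => if b then p (enum_val i) else enum_val i
  | Some (inr j) => enum_val j
  end.
have Aval (i : 'I_#|A|) : enum_val i != v /\
    enum_rank (enum_val i) < enum_rank (p (enum_val i)).
  by have := enum_valP i; rewrite inE => /andP.
have Cval (j : 'I_#|C|) : enum_val j != v /\ p (enum_val j) = enum_val j.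
  by have := enum_valP j; rewrite inE => /andP [? /eqP].
have fv y : f (Some y) != v.
  case: y => [[i []]|j] /=; [apply: pN| |]; by case: (Aval i) || case: (Cval j).
have fT i b j c : f (Some (inl (i, b))) = f (Some (inl (j, c))) -> (i, b) = (j, c).
  have [iv ri] := Aval i; have [jv rj] := Aval j.
  case: b c => [] [] /= E.
  - by move/(congr1 p): E; rewrite !pK // => /enum_val_inj ->.
  - by move: rj; rewrite -E pK // ltnNge ltnW.
  - by move: ri; rewrite E pK // ltnNge ltnW.
  - by move/enum_val_inj: E => ->.
have pfT i b : p (f (Some (inl (i, b)))) = f (Some (inl (i, ~~ b))).
  by have [iv _] := Aval i; case: b => //=; rewrite pK.
have pfP j : p (f (Some (inr j))) = f (Some (inr j)) by have [] := Cval j.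
have fTP i b j : f (Some (inl (i, b))) <> f (Some (inr j)).
  by move=> E; have := pfP j; rewrite -E pfT => /fT []; case: (b).
have f_inj : injective f.
  move=> [x|] [y|] // E; last 2 first.
  - by have := fv x; rewrite E eqxx.
  - by have := fv y; rewrite -E eqxx.
  congr Some; case: x y E => [[i b]|i] [[j c]|j] E.
  - by rewrite (fT _ _ _ _ E).
  - by case: (fTP _ _ _ E).
  - by case: (fTP _ _ _ (esym E)).
  - by rewrite (enum_val_inj E).
have f_mono : {mono f : x y / adj x y}.
  move=> [x|] [y|]; last exact: adj_irrefl.
  - rewrite adjE // (inj_eq f_inj); case: x => [[i b]|j].
      rewrite pfT (inj_eq f_inj); case: y => [[j c]|j] //=.
      rewrite !(inj_eq (@Some_inj _)) !(inj_eq (@inl_inj _ _)) !xpair_eqE.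
      by case: (i == j); case: b; case: c.
    by rewrite pfP (inj_eq f_inj) andbN; case: y => [[]|].
  - by rewrite adj_sym (dom _ (fv x)); case: (x) => [[]|].
  - by rewrite (dom _ (fv y)).
have f_surj x : exists h, f h = x.
  have [->|xv] := eqVneq x v; first by exists None.
  have [px|px] := eqVneq (p x) x.
    have xC : x \in C by rewrite inE xv px eqxx.
    by exists (Some (inr (enum_rank_in xC x))); rewrite /= enum_rankK_in.
  have [r|r] := ltnP (enum_rank x) (enum_rank (p x)).
    have xA : x \in A by rewrite inE xv.
    by exists (Some (inl (enum_rank_in xA x, false))); rewrite /= enum_rankK_in.
  have pA : p x \in A.
    rewrite inE pN // pK // ltn_neqAle r andbT.
    by rewrite (inj_eq val_inj) (inj_eq enum_rank_inj).
  by exists (Some (inl (enum_rank_in pA (p x), true))); rewrite /= enum_rankK_in // pK.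
exists #|A|, #|C|; apply: isomorphic_sym; exists f => //.
apply: inj_card_bij f_inj _; apply: leq_trans (leq_image_card f predT).
apply: subset_leq_card; apply/subsetP => x _.
by have [h <-] := f_surj x; apply: codom_f.
Qed.

Lemma card_H (s k : nat) : #|H s k| = 2 * s + k + 1.
Proof. by rewrite card_option card_sum card_prod !card_ord card_bool mulnC addn1. Qed.

Lemma isomorphic_card (G G' : sgraph) : isomorphic G G' -> #|G| = #|G'|.
Proof. by case=> f /bij_eq_card. Qed.

Lemma matching_number_isomorphic (G G' : sgraph) :
  isomorphic G G' -> matching_number G = matching_number G'.
Proof.
suff le (G1 G2 : sgraph) : isomorphic G1 G2 ->
    matching_number G1 <= matching_number G2.
  by move=> iso; apply/eqP; rewrite eqn_leq !le //; apply: isomorphic_sym.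
case=> f f_bij fE; have f_inj := bij_inj f_bij.
apply/bigmax_leqP => M /andP [/subsetP M_edges trivM].
rewrite -(card_imset (mem M) (imset_inj f_inj)).
apply: leq_bigmax_cond; apply/andP; split.
  apply/subsetP => _ /imsetP [e eM ->].
  have /imsetP [[x y]] := M_edges e eM; rewrite inE /= => xy ->.
  rewrite imsetU !imset_set1; apply/imsetP; exists (f x, f y) => //.
  by rewrite inE /= fE.
apply/trivIsetP => _ _ /imsetP [e eM ->] /imsetP [e' eM' ->] ee'.
rewrite imset_disjoint //.
by apply: (trivIsetP trivM) => //; apply: contraNneq ee' => ->.
Qed.

(** Upper bound: at most one edge of a matching contains the centre, and the
    others are triangle edges that avoid it. Lower bound: those triangle edges,
    together with one pendant edge. *)
Lemma matching_number_H (s k : nat) : 0 < k -> matching_number (H s k) = s + 1.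
Proof.
move=> k0; apply/eqP; rewrite eqn_leq; apply/andP; split.
- apply/bigmax_leqP => M /andP [/subsetP M_edges trivM].
  pose F (o : option 'I_s) : {set H s k} := match o with
    | None => odflt set0 [pick e in M | None \in e]
    | Some i => [set Some (inl (i, true)); Some (inl (i, false))] end.
  have sub : {subset M <= codom F}.
    move=> e eM; have [Ne|Ne] := boolP (None \in e).
      suff -> : e = F None by apply: codom_f.
      rewrite /F; case: pickP => [e' /andP [eM' Ne']|/(_ e)] /=; last by rewrite eM Ne.
      apply/eqP; apply: contraT => /(trivIsetP trivM _ _ eM eM') /disjointFr.
      by move=> /(_ _ Ne); rewrite Ne'.
    have /imsetP [[x y]] := M_edges e eM; rewrite inE /= => xy eE.
    move: Ne xy; rewrite eE !inE negb_or.
    case: x y {eE} => [[[i b]|j]|] [[[i' b']|j']|] //= _ /andP [/eqP <- bb'].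
    suff -> : [set Some (inl (i, b)); Some (inl (i, b'))] = F (Some i) by apply: codom_f.
    by case: b b' bb' => [] [] //= _; rewrite setUC.
  rewrite addn1 -[X in X.+1]card_ord -card_option.
  apply: leq_trans (leq_image_card F predT).
  by apply: subset_leq_card; apply/subsetP => e /sub.
- pose j0 := Ordinal k0.
  pose t (x : H s k) : H s k := match x with
    | None => Some (inr j0)
    | Some (inl (i, b)) => Some (inl (i, ~~ b))
    | Some (inr j) => if j == j0 then None else x end.
  have tK : involutive t.
    move=> [[[i b]|j]|] //=; rewrite ?eqxx ?negbK //.
    by have [->|jj0] := eqVneq j j0; rewrite //= (negbTE jj0).
  have t_moves : 2 * (s + 1) <= #|[set x | t x != x]|.
    pose P := [set (Some (inr j) : H s k) | j in [set~ j0]].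
    have := cardsC [set x | t x != x]; rewrite card_H.
    have : #|~: [set x | t x != x]| <= #|P|.
      apply: subset_leq_card; apply/subsetP => x; rewrite !inE negbK.
      case: x => [[[i b]|j]|] //=.
        by move=> /eqP []; case: b.
      have [//|jj0 _] := eqVneq j j0.
      by apply/imsetP; exists j; rewrite ?inE.
    rewrite card_imset; last by move=> j j' [].
    rewrite cardsC1 card_ord; move: #|~: _| #|[set x | _]| => c d.
    lia.
  rewrite -(leq_pmul2l (isT : 0 < 2)); apply: leq_trans t_moves _.
  apply: involution_matching => // x.
  case: x => [[[i b]|j]|] //=; first by rewrite eqxx; case: b.
  by case: (j == j0) => //; rewrite eqxx.
Qed.

Lemma matching_number_H0_ge (s : nat) : s <= matching_number (H s 0).
Proof.
pose t (x : H s 0) : H s 0 :=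
  if x is Some (inl (i, b)) then Some (inl (i, ~~ b)) else x.
have tK : involutive t by move=> [[[i b]|[]]|] //=; rewrite negbK.
have t_moves : [set x | t x != x] = [set~ None].
  apply/setP => -[[[i b]|[]]|] //; rewrite !inE //=.
  by apply/eqP => -[]; case: b.
have := involution_matching (H s 0) t tK.
rewrite t_moves cardsC1 card_H addn0 addn1 leq_mul2l; apply.
by case=> [[[i b]|[]]|] //=; rewrite eqxx; case: b.
Qed.

Lemma dominating_of_degree (G : sgraph) (v : G) : #|G| <= degree v + 1 ->
  forall x, x != v -> adj v x.
Proof.
move=> dv x xv; apply: contraT => nvx.
have : degree v <= #|~: [set v; x]|.
  apply/subset_leq_card/subsetP => u; rewrite !inE negb_or => vu.
  by apply/andP; split; apply/eqP => E; rewrite E ?adj_irrefl ?(negbTE nvx) in vu.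
have := cardsC [set v; x]; rewrite cards2 eq_sym xv.
move: #|~: _| (degree v) dv => c d; lia.
Qed.

(** Take an edge v - a. If neither end dominates, let w and w' be vertices not
    adjacent to v and to a, respectively.  Every edge meets v - a, hence a - w
    and v - w' are edges, and they are disjoint. *)
Lemma dominating_of_matching_number1 (G : sgraph) : connected G ->
  1 < #|G| -> matching_number G <= 1 -> exists v : G, forall x, x != v -> adj v x.
Proof.
move=> conn n1 m1; have /card_gt0P [v _] : 0 < #|G| by lia.
have /card_gt0P [a] := connected_degree_gt0 G v conn n1; rewrite inE => va.
have meet (x y x' y' : G) : adj x y -> adj x' y' ->
    x != x' -> x != y' -> y != x' -> y != y' -> False.
  move=> xy xy' xx' xy1 yx' yy'.
  suff : 2 <= matching_number G by rewrite leqNgt ltnS m1.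
  apply: leq_trans (_ : #|[set [set x; y]; [set x'; y']]| <= _).
    rewrite cards2; suff -> : [set x; y] != [set x'; y'] by [].
    by apply/eqP => /setP /(_ x); rewrite !inE eqxx (negbTE xx') (negbTE xy1).
  apply: leq_bigmax_cond; apply/andP; split.
    apply/subsetP => e; rewrite !inE => /orP [] /eqP ->; apply/imsetP.
      by exists (x, y); rewrite ?inE.
    by exists (x', y'); rewrite ?inE.
  have dis : [disjoint [set x; y] & [set x'; y']].
    apply/pred0Pn => -[z /andP []] /=; rewrite !inE => /orP [] /eqP -> /orP [] /eqP E;
    by rewrite E eqxx in xx' xy1 yx' yy'.
  apply/trivIsetP => e e'; rewrite !inE => /orP [] /eqP -> /orP [] /eqP ->;
    rewrite ?eqxx // => _; by rewrite // disjoint_sym.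
have irr (x y : G) : adj x y -> x != y.
  by move=> xy; apply/eqP => E; rewrite E adj_irrefl in xy.
have [/forallP dom|/forallPn [w]] := boolP [forall x, (x != v) ==> adj v x].
  by exists v => x; apply/implyP.
rewrite negb_imply => /andP [wv nvw].
exists a => w' w'a; apply: contraT => naw'.
have w'v : w' != v by apply/eqP => E; rewrite E adj_sym va in naw'.
have touch (x : G) : x != v -> x != a -> adj v x || adj a x.
  move=> xv xa; have /card_gt0P [y] := connected_degree_gt0 G x conn n1.
  rewrite inE => xy; apply: contraT; rewrite negb_or => /andP [nvx nax].
  case: (meet v a x y va xy); rewrite 1?eq_sym //.
    by apply/eqP => E; rewrite adj_sym -E xy in nvx.
  by apply/eqP => E; rewrite adj_sym -E xy in nax.
have wa : w != a by apply/eqP => E; rewrite E va in nvw.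
have aw : adj a w by have := touch w wv wa; rewrite (negbTE nvw).
have vw' : adj v w' by have := touch w' w'v w'a; rewrite (negbTE naw') orbF.
case: (meet a w v w' aw vw') => //; rewrite 1?eq_sym //; first exact: irr.
by apply/eqP => E; rewrite E aw in naw'.
Qed.

(** * Eigenvalues and test functions *)

Local Open Scope ring_scope.

(** The signless Laplacian as an operator on functions on the vertices; the
    degree term is spread over the edges. *)
Definition slap (R : realType) (G : sgraph) (z : G -> R) (x : G) : R :=
  \sum_(y | adj x y) (z x + z y).

Definition eigenfunction (R : realType) (G : sgraph) (mu : R) (z : G -> R) :=
  (exists x, z x != 0) /\ forall x, slap R G z x = mu * z x.

Lemma eigenvalue_eigenfunction (R : realType) (G : sgraph) (mu : R) :
  eigenvalue (signless_laplacian R G) mu <->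
  exists z : G -> R, eigenfunction R G mu z.
Proof.
have mulE (v : 'rV[R]_#|G|) j :
    (v *m signless_laplacian R G) 0 j
    = slap R G (fun x => v 0 (enum_rank x)) (enum_val j).
  rewrite /slap big_split /= sumr_const /signless_laplacian mulmxDr mxE.
  rewrite mul_mx_diag !mxE enum_valK mulr_natr /degree cardsE; congr (_ + _).
  rewrite (reindex (@enum_val G predT)) /=; last exact: onW_bij (enum_val_bij G).
  rewrite [RHS]big_mkcond /=; apply: eq_bigr => i _.
  by rewrite mxE adj_sym enum_valK; case: adj; rewrite ?mulr1 ?mulr0.
split.
- case/eigenvalueP => v vQ v0; exists (fun x => v 0 (enum_rank x)); split.
    case/rV0Pn: v0 => j vj; exists (enum_val j); by rewrite enum_valK.
  move=> x; have := mulE v (enum_rank x).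
  by rewrite vQ enum_rankK mxE => <-.
- case=> z [[x zx] zE]; apply/eigenvalueP.
  exists (\row_j z (enum_val j)).
    apply/rowP => j; rewrite mulE !mxE -zE /slap.
    by apply: eq_bigr => y _; rewrite !mxE !enum_rankK.
  by apply/rV0Pn; exists (enum_rank x); rewrite mxE enum_rankK.
Qed.

(** At a vertex where |z| / x is maximal, the triangle inequality bounds
    |mu z| by the same multiple of Q x, hence by la |z|. *)
Lemma eigenvalue_le (R : realType) (G : sgraph) (la mu : R) (x z : G -> R) :
  (forall v, 0 < x v) -> (forall v, slap R G x v <= la * x v) ->
  eigenfunction R G mu z -> mu <= la.
Proof.
move=> x_gt0 xla [[u zu] zmu].
pose r v := `|z v| / x v.
have [v _ rmax] := @Order.TotalTheory.arg_maxP _ _ _ u predT r isT.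
have zle w : `|z w| <= r v * x w.
  by rewrite -ler_pdivrMr //; apply: rmax.
have zvE : `|z v| = r v * x v by rewrite /r divfK // gt_eqF.
have rv : 0 < r v.
  rewrite (lt_le_trans _ (rmax u isT)) // divr_gt0 // normr_gt0 //.
have: mu * `|z v| <= la * `|z v|.
  apply: le_trans (_ : `|mu * z v| <= _).
    by rewrite normrM ler_wpM2r // ler_norm.
  rewrite -zmu zvE mulrCA; apply: le_trans (_ : r v * slap R G x v <= _).
    rewrite /slap mulr_sumr; apply: le_trans (ler_norm_sum _ _ _) _.
    apply: ler_sum => w _; rewrite mulrDr; apply: le_trans (ler_normD _ _) _.
    exact: lerD.
  by rewrite ler_pM2l.
by rewrite ler_pM2r // zvE mulr_gt0.
Qed.

(** The assumption 0 <= la covers the supremum of the empty set, which is 0. *)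
Lemma q_le (R : realType) (G : sgraph) (la : R) (x : G -> R) :
  0 <= la ->
  (forall v, 0 < x v) -> (forall v, slap R G x v <= la * x v) -> q R G <= la.
Proof.
move=> la0 x_gt0 xla; rewrite /q.
have [->|/set0P S0] := eqVneq
  [set mu : R | eigenvalue (signless_laplacian R G) mu]%classic classical_sets.set0.
  by rewrite sup0.
apply: ge_sup => // mu /= /eigenvalue_eigenfunction [z zmu].
exact: eigenvalue_le zmu.
Qed.

Lemma q_positive_eigenfunction (R : realType) (G : sgraph) (la : R)
    (x : G -> R) (v : G) :
  (forall v, 0 < x v) -> (forall v, slap R G x v = la * x v) -> q R G = la.
Proof.
move=> x_gt0 xla; rewrite /q.
have x_eig : eigenfunction R G la x by split=> //; exists v; rewrite gt_eqF.
have ub : ubound [set mu : R | eigenvalue (signless_laplacian R G) mu]%classic la.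
  move=> mu /= /eigenvalue_eigenfunction [z zmu].
  by apply: eigenvalue_le zmu => // w; rewrite xla.
have la_in : eigenvalue (signless_laplacian R G) la.
  by apply/eigenvalue_eigenfunction; exists x.
apply/le_anti/andP; split; first by apply: ge_sup ub; exists la.
by apply: ub_le_sup => //; exists la.
Qed.

Lemma q_isomorphic (R : realType) (G G' : sgraph) :
  isomorphic G G' -> q R G = q R G'.
Proof.
suff sub (G1 G2 : sgraph) : isomorphic G1 G2 ->
    ([set mu : R | eigenvalue (signless_laplacian R G2) mu] `<=`
     [set mu : R | eigenvalue (signless_laplacian R G1) mu])%classic.
  move=> iso; rewrite /q; congr sup; apply/seteqP.
  by split; apply: sub => //; apply: isomorphic_sym.
case=> f f_bij fE mu /= /eigenvalue_eigenfunction [z [[x zx] zE]].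
apply/eigenvalue_eigenfunction; exists (z \o f); split.
  by case: f_bij => g fK gK; exists (g x); rewrite /= gK.
move=> y; rewrite /= -zE /slap (reindex f) /=; last exact: onW_bij.
by apply: eq_bigl => w; rewrite fE.
Qed.

(** * The spectrum of H s k *)

Lemma H_neighbour_sum (R : realType) (s k : nat) (F : H s k -> R) :
  [/\ \sum_(y | @adj (H s k) None y) F y =
        \sum_(i < s) \sum_(b : bool) F (Some (inl (i, b))) +
        \sum_(j < k) F (Some (inr j)),
      forall i b, \sum_(y | @adj (H s k) (Some (inl (i, b))) y) F y =
        F None + F (Some (inl (i, ~~ b)))
    & forall j, \sum_(y | @adj (H s k) (Some (inr j)) y) F y = F None].
Proof.
have sumE (P : pred (H s k)) : \sum_(y | P y) F y =
    (if P None then F None else 0) +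
    (\sum_(ib | P (Some (inl ib))) F (Some (inl ib)) +
     \sum_(j | P (Some (inr j))) F (Some (inr j))).
  rewrite big_mkcond (bigD1 None) //=; congr (_ + _).
  rewrite -big_mkcondr /=.
  rewrite (reindex_omap (op := +%R) Some id) /=; last by case.
  under eq_bigl => y do rewrite eqxx andbT.
  exact: big_sumType.
split.
- rewrite sumE /= add0r; congr (_ + _).
  by rewrite pair_big /=; apply: eq_bigr => -[].
- move=> i b; rewrite sumE /= big_pred0_eq addr0; congr (_ + _).
  rewrite (big_pred1 (i, ~~ b)) // => -[j c] /=.
  by rewrite [RHS]xpair_eqE eq_sym; case: b; case: c.
- by move=> j; rewrite sumE /= !big1 ?addr0 // => -[].
Qed.

Lemma natr_twice_add (R : realType) (s k : nat) :
  (2 * s + k)%:R = 2 * s%:R + k%:R :> R.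
Proof. by rewrite natrD natrM. Qed.

Lemma natr_H_order (R : realType) (s k : nat) :
  (2 * s + k + 1)%:R = 2 * s%:R + k%:R + 1 :> R.
Proof. by rewrite natrD natr_twice_add. Qed.

(** Eliminating the values at the triangles and at the pendants from the
    equations of an eigenfunction constant on each of the two classes leaves
    this equation at the centre. *)
Definition H_poly (R : realType) (s k : nat) (x : R) : R :=
  (x - (2 * s + k)%:R) * (x - 3) * (x - 1) - 2 * s%:R * (x - 1) - k%:R * (x - 3).

Definition H_vector (R : realType) (s k : nat) (mu : R) (x : H s k) : R :=
  match x with
  | None => (mu - 3) * (mu - 1)
  | Some (inl _) => mu - 1
  | Some (inr _) => mu - 3
  end.

Lemma H_vector_gt0 (R : realType) (s k : nat) (mu : R) (x : H s k) :
  3 < mu -> 0 < H_vector R s k mu x.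
Proof. by move=> mu3; case: x => [[?|?]|] /=; rewrite ?mulr_gt0 //; lra. Qed.

(** The test function solves the equations at triangles and pendants for every
    mu, and [H_poly] is the defect at the centre. *)
Lemma slap_H_vector (R : realType) (s k : nat) (mu : R) (x : H s k) :
  slap R (H s k) (H_vector R s k mu) x =
  mu * H_vector R s k mu x - (if x is None then H_poly R s k mu else 0).
Proof.
rewrite /slap.
have [sumN sumT sumP] :=
  H_neighbour_sum R s k (fun y => H_vector R s k mu x + H_vector R s k mu y).
case: x sumN sumT sumP => [[[i b]|j]|] sumN sumT sumP.
- by rewrite sumT /=; ring.
- by rewrite sumP /=; ring.
- rewrite sumN /= !sumr_const !card_ord card_bool /H_poly natr_twice_add.
  ring.
Qed.

Lemma q_H_le (R : realType) (s k : nat) (mu : R) :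
  3 < mu -> 0 <= H_poly R s k mu -> q R (H s k) <= mu.
Proof.
move=> mu3 f0; apply: (q_le _ _ _ (H_vector R s k mu)); first by lra.
  by move=> v; apply: H_vector_gt0.
by move=> v; rewrite slap_H_vector; case: v => [?|]; rewrite ?subr0 // gerBl.
Qed.

Lemma q_H_root (R : realType) (s k : nat) (mu : R) :
  3 < mu -> H_poly R s k mu = 0 -> q R (H s k) = mu.
Proof.
move=> mu3 f0.
apply: (q_positive_eigenfunction _ _ _ (H_vector R s k mu) None).
  by move=> v; apply: H_vector_gt0.
by move=> v; rewrite slap_H_vector f0; case: (v) => [?|]; rewrite subr0.
Qed.

Lemma H_poly_ivt (R : realType) (s k : nat) (a b c : R) : a <= b ->
  H_poly R s k a <= c <= H_poly R s k b ->
  exists2 x, a <= x <= b & H_poly R s k x = c.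
Proof.
move=> ab abc.
pose p : {poly R} := ('X - (2 * s + k)%:R%:P) * ('X - 3%:P) * ('X - 1%:P)
  - (2 * s%:R) *: ('X - 1%:P) - k%:R *: ('X - 3%:P) - c%:P.
have pE x : p.[x] = H_poly R s k x - c by rewrite /p !hornerE.
have [|x xab /rootP px] := @poly_ivt R p a b ab.
  by rewrite !pE subr_le0 subr_ge0.
by exists x => //; apply/eqP; rewrite -subr_eq0 -pE px.
Qed.

Lemma H_poly_order (R : realType) (s k : nat) :
  H_poly R s k (2 * s + k + 1)%:R = - 4 * s%:R.
Proof. rewrite /H_poly !natr_H_order !natr_twice_add; ring. Qed.

(** The cubic is at most 0 at the order n and at least 0 at n + 2, so it has a
    root in between; as n > 3, the test function is positive there. *)
Lemma q_H_ge_order (R : realType) (s k : nat) : (2 < 2 * s + k)%N ->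
  (2 * s + k + 1)%:R <= q R (H s k) /\ H_poly R s k (q R (H s k)) = 0.
Proof.
move=> sk; set n : R := (2 * s + k + 1)%:R.
have s0 : 0 <= s%:R :> R by rewrite ler0n.
have n3 : 3 < n by rewrite /n ltr_nat; lia.
have [||mu /andP[nmu _] f0] := H_poly_ivt R s k n (n + 2) 0; first by lra.
  apply/andP; split; first by rewrite H_poly_order; lra.
  have -> : H_poly R s k (n + 2) = 2 * (2 * s + k)%:R ^+ 2 + 8 * s%:R + 6 * k%:R.
    by rewrite /H_poly /n !natr_H_order !natr_twice_add; ring.
  by rewrite !addr_ge0 ?mulr_ge0 ?sqr_ge0 ?ler0n.
by rewrite (q_H_root R s k mu) //; apply: lt_le_trans nmu.
Qed.

(** * The extremal graphs *)

Lemma q_le_order (R : realType) (G : sgraph) : cactus G -> (1 < #|G|)%N ->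
  (2 * matching_number G < #|G|)%N -> (forall v : G, degree v + 1 < #|G|)%N ->
  q R G <= #|G|%:R.
Proof.
move=> cactG n1 mn nodom.
apply: (q_le _ _ _ (fun v => (degree v)%:R)); first exact: ler0n.
  by move=> v; rewrite ltr0n; apply: connected_degree_gt0 n1; case: cactG.
move=> v; rewrite /slap big_split /= sumr_const.
have -> : #|adj v| = degree v by rewrite /degree cardsE.
rewrite -natr_sum -[_ *+ _]mulr_natr -!natrM -natrD ler_nat addnC.
exact: sum_neighbour_degrees_le.
Qed.

(** The last equation is what [H_poly] amounts to for k = 0, after division by
    la - 1. *)
Lemma order_lt_friendship_bound (R : realType) (m : nat) : (0 < m)%N ->
  let n := (2 * m + 1)%:R : R in
  let la := ((n + 2) + Num.sqrt (n ^+ 2 - 4 * n + 12)) / 2 in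
  n < la /\ (la - n + 1) * (la - 3) = n - 1.
Proof.
move=> m0 n la; have n3 : 3 <= n by rewrite /n ler_nat; lia.
set r := Num.sqrt (n ^+ 2 - 4 * n + 12) in la *.
have rr : r ^+ 2 = n ^+ 2 - 4 * n + 12 by rewrite sqr_sqrtr //; nra.
have r0 : 0 <= r by rewrite sqrtr_ge0.
split; last by rewrite /la; lra.
suff : n - 2 < r by rewrite /la; lra.
rewrite -(ltr_pXn2r (n := 2)) ?nnegrE ?rr //; [nra|lra].
Qed.

(** The cubic of H s k has the value 2 k > 1 at la and is at most 0 at n, so it
    takes the value 1 strictly between them.  Aiming at 1 rather than at a root
    keeps mu away from n, which may be 3, where the test function vanishes. *)
Lemma q_H_lt_friendship_bound (R : realType) (s k : nat) (la : R) :
  let n := (2 * s + k + 1)%:R : R in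
  3 <= n -> (0 < k)%N -> n < la -> (la - n + 1) * (la - 3) = n - 1 ->
  q R (H s k) < la.
Proof.
move=> n n3 k0 nla laE.
have k1 : 1 <= k%:R :> R by rewrite ler1n.
have s0 : 0 <= s%:R :> R by rewrite ler0n.
have H_la : H_poly R s k la = 2 * k%:R.
  transitivity ((la - 1) * ((la - n + 1) * (la - 3) - (n - 1)) + 2 * k%:R).
    by rewrite /H_poly /n !natr_H_order !natr_twice_add; ring.
  by rewrite laE subrr mulr0 add0r.
have [||mu /andP [nmu mula] H_mu] := H_poly_ivt R s k n la 1.
- exact: ltW.
- by rewrite H_la H_poly_order; apply/andP; split; lra.
have mu3 : 3 < mu.
  rewrite lt_neqAle (le_trans n3 nmu) andbT; apply/eqP => mu3.
  have nmu' : mu = n by apply/le_anti; rewrite -{1}mu3 n3 nmu.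
  by move: H_mu; rewrite nmu' H_poly_order; lra.
apply: le_lt_trans (q_H_le R s k mu mu3 _) _; first by rewrite H_mu.
rewrite lt_neqAle mula andbT; apply/eqP => E.
by move: H_mu; rewrite E H_la; lra.
Qed.

Theorem theorem3p1 (R : realType) (n m : nat) (G : sgraph)
    (n_gt0 : (0 < n)%N) (m_gt0 : (0 < m)%N) (G_cactus : cacti n m G) :
  (n = (2 * m + 1)%N ->
     q R G <= ((n%:R + 2) + Num.sqrt (n%:R ^+ 2 - 4 * n%:R + 12)) / 2 /\
     (q R G = ((n%:R + 2) + Num.sqrt (n%:R ^+ 2 - 4 * n%:R + 12)) / 2 <->
        isomorphic G (H m 0))) /\
  ((2 * m + 2 <= n)%N ->
     [/\ q R G <= q R (H (m - 1) (n - 2 * m + 1)),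
         q R G = q R (H (m - 1) (n - 2 * m + 1)) <->
           isomorphic G (H (m - 1) (n - 2 * m + 1))
       & is_largest_root
           (fun x : R =>
              x ^+ 3 - (n%:R + 3) * x ^+ 2 + 3 * n%:R * x - 4 * m%:R + 4)
           (q R (H (m - 1) (n - 2 * m + 1)))]).
Proof.
case: G_cactus => cactG cardG matchG.
(* Both parts compare G with an extremal graph H0; the bound and its equality
   case follow together from this alternative. *)
have dichotomy (H0 : sgraph) : isomorphic G H0 \/ q R G < q R H0 ->
    q R G <= q R H0 /\ (q R G = q R H0 <-> isomorphic G H0).
  move=> [iso|lt]; first by rewrite (q_isomorphic R G H0 iso).
  split; first exact: ltW.
  by split=> [E|/(q_isomorphic R) E]; move: lt; rewrite E ltxx.
(* In the second alternative m >= 2 makes the bounds of both parts exceed n. *)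
have shape : (2 * m < n)%N ->
    (exists s k, isomorphic G (H s k)) \/ (2 <= m)%N /\ q R G <= n%:R.
  move=> mn; have n1 : (1 < #|G|)%N by lia.
  have [/existsP [v /forallP dom]|nodom] :=
    boolP [exists v, [forall x, (x != v) ==> @adj G v x]].
    left; apply: (dominating_isomorphic G v cactG) => x; exact/implyP.
  right; split.
    rewrite ltnNge; apply/negP => m1.
    case: (dominating_of_matching_number1 G _ n1); rewrite ?matchG //.
      by case: cactG.
    move=> v dom; case/existsP: nodom; exists v; apply/forallP => x.
    exact/implyP/dom.
  rewrite -cardG; apply: q_le_order => //; first by rewrite matchG cardG.
  move=> v; rewrite ltnNge; apply/negP => /dominating_of_degree dom.
  case/existsP: nodom; exists v; apply/forallP => x; exact/implyP/dom.
split=> [nE|mn].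
- have [] := order_lt_friendship_bound R m m_gt0; rewrite -nE.
  set la := _ / 2 => nla laE.
  have n3 : 3 <= n%:R :> R by rewrite ler_nat; lia.
  have qla : q R (H m 0) = la.
    apply: q_H_root; first exact: le_lt_trans nla.
    transitivity ((la - 1) * ((la - n%:R + 1) * (la - 3) - (n%:R - 1))).
      by rewrite nE /H_poly natr_twice_add natrD natrM; ring.
    by rewrite laE subrr mulr0.
  rewrite -qla; apply: dichotomy.
  have [|[s [k iso]]|[_ qn]] := shape; first by lia.
    have := isomorphic_card _ _ iso; rewrite card_H cardG => nE'.
    case: (posnP k) => [k0|k0].
      left; suff <- : s = m by rewrite -k0.
      by lia.
    right; rewrite qla (q_isomorphic _ _ _ iso).
    by apply: q_H_lt_friendship_bound; rewrite -?nE'.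
  by right; rewrite qla; apply: le_lt_trans nla.
- set s := (m - 1)%N; set k := (n - 2 * m + 1)%N.
  have mE : m = (s + 1)%N by rewrite /s; lia.
  have nE : n = (2 * s + k + 1)%N by rewrite /s /k; lia.
  have [nq root_q] : n%:R <= q R (H s k) /\ H_poly R s k (q R (H s k)) = 0.
    by rewrite nE; apply: q_H_ge_order; rewrite /s /k; lia.
  have polyE (x : R) :
      x ^+ 3 - (n%:R + 3) * x ^+ 2 + 3 * n%:R * x - 4 * m%:R + 4 = H_poly R s k x.
    by rewrite nE mE /H_poly !natr_H_order !natr_twice_add natrD; ring.
  have root_max : is_largest_root (fun x : R =>
      x ^+ 3 - (n%:R + 3) * x ^+ 2 + 3 * n%:R * x - 4 * m%:R + 4) (q R (H s k)).
    (* A root of the cubic above 3 is itself the largest eigenvalue. *)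
    split=> [|y]; rewrite polyE // => root_y; rewrite leNgt; apply/negP => qy.
    have n3 : 3 < n%:R :> R by rewrite ltr_nat; lia.
    have y3 : 3 < y by apply: lt_trans qy; apply: lt_le_trans nq.
    by move: qy; rewrite (q_H_root R s k y) ?ltxx.
  suff /dichotomy [] : isomorphic G (H s k) \/ q R G < q R (H s k) by [].
  have [|[s' [k' iso]]|[m2 qn]] := shape; first by lia.
    left; have := isomorphic_card _ _ iso; rewrite card_H cardG => nE'.
    have := matching_number_isomorphic _ _ iso; rewrite matchG.
    case: (posnP k') => [k0|k0].
      by rewrite k0; have := matching_number_H0_ge s'; lia.
    rewrite matching_number_H // => mE'.
    have -> : s = s' by lia.
    by have -> : k = k' by lia.
  right; apply: le_lt_trans qn _; rewrite lt_neqAle nq andbT.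
  apply/eqP => E; move: root_q; rewrite -E nE H_poly_order.
  have : 1 <= s%:R :> R by rewrite ler1n /s; lia.
  lra.
Qed.
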